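(* Let $p\equiv 1\pmod 4$ be a prime and let $\alpha$ be a positive integer. Let $p=a^2+b^2$, where $a$ and $b$ are integers such that $a$ is even. Then the number $\mathcal{K}_4(G_{p^\alpha})$ of cliques of order four in the Paley-type graph $G_{p^\alpha}$ is $$\mathcal{K}_4(G_{p^\alpha})=\frac{p^{4\alpha-3}(p-1)\{(p-9)^2-4a^2\}}{1536}.$$
   Context: For a prime $p\equiv 1\pmod 4$ and $\alpha\geq 1$, let $n=p^\alpha$ and let $\mathbb{Z}_n^\ast$ be the group of units of $\mathbb{Z}_n=\mathbb{Z}/n\mathbb{Z}$. The Paley-type graph $G_n$ is the simple undirected graph with vertex set $\mathbb{Z}_n$ in which $xy$ is an edge if and only if $x-y\equiv c^2\pmod n$ for some $c\in\mathbb{Z}_n^\ast$ (this is symmetric since $-1$ is a square in $\mathbb{Z}_n^\ast$). For a graph $G$, $\mathcal{K}_m(G)$ denotes the number of cliques of order $m$ in $G$, i.e. the number of $m$-element sets of pairwise adjacent vertices. *)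

(* Defs.v *)
From mathcomp Require Import all_boot all_order all_algebra.
Set Implicit Arguments.
Unset Strict Implicit.
Unset Printing Implicit Defensive.
Import GRing.Theory.
Local Open Scope ring_scope.

Definition is_clique (T : finType) (e : rel T) (A : {set T}) : bool :=
  [forall x in A, forall y in A, (x != y) ==> e x y].

Definition num_cliques (T : finType) (e : rel T) (m : nat) : nat :=
  #|[set A : {set T} | is_clique e A && (#|A| == m)]|.

(* 'Z_n is Z/nZ only for 1 < n.  For n = p ^ alpha with p prime, p = 1 mod 4
   and 0 < alpha, -1 is the square of a unit, so this relation is symmetric;
   it is irreflexive since 0 is not a unit. *)
Definition paley_edge (n : nat) : rel 'Z_n :=
  fun x y => [exists c : 'Z_n, (c \is a GRing.unit) && (x - y == c ^+ 2)].
Arguments paley_edge n : clear implicits.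

(* Main.v *)
(* The kernel of (Z/p^alpha)^* -> F_p^* has odd order, so every element of it is
   a square; hence adjacency in G_(p^alpha) only depends on residues modulo p,
   and ordered 4-cliques of G_(p^alpha) number p^(4(alpha-1)) times those of the
   Paley graph of F_p.  The latter is transitive on directed edges, so one counts
   the edges inside the common neighbourhood of 0 and 1.  Expanding this in the
   quadratic character chi leaves a single nonelementary sum,
     T = sum_(x,y) chi(x y (x-1) (y-1) (x-y)).
   Substituting squares for x and y and applying a Cayley transform,
     T = U := sum_(x,u) chi(x u (x-u) (1-x u)).
   With J(r) = sum_x chi(x (x^2-r)) and a nonsquare n, summing chi(r) J(r)^2 over
   r gives 2 U = J(1)^2 - J(n)^2, while summing J(r)^2 gives
   J(1)^2 + J(n)^2 = 4 p.  Since J(1)/2 is odd, uniqueness of the representation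
   of p as a sum of two squares yields J(n)^2 = 4 a^2, i.e. T = 2 p - 4 a^2. *)
Require Import Defs.
From mathcomp Require Import all_boot all_order all_fingroup all_algebra.
From mathcomp Require Import all_solvable all_field.
From mathcomp Require Import ring zify.
Set Implicit Arguments.
Unset Strict Implicit.
Unset Printing Implicit Defensive.
Import GRing.Theory Num.Theory.
Local Open Scope ring_scope.

(** * The quadratic character *)

Section QuadraticCharacter.

Variable F : finFieldType.
Hypothesis card_mod4 : (#|F| = 1 %[mod 4])%N.

Lemma finField_generator : exists g : F,
  [/\ g != 0, g ^+ (#|F|.-1 %/ 2) != 1 & forall x, x != 0 -> exists i, x = g ^+ i].
Proof.
have /cyclicP [g gE] := field_unit_group_cyclic [set: {unit F}]%G.
have og : #[g]%g = #|F|.-1 by rewrite orderE -gE card_finField_unit.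
have F1 : (1 < #|F|)%N := finNzRing_gt1 F.
have F5 : (0 < #|F|.-1 %/ 2 < #|F|.-1)%N by lia.
exists (val g); split.
- by have := FinRing.uval g; case: g {gE og} => g /=; rewrite unitfE.
- apply/eqP => /= g1.
  have : (g ^+ (#|F|.-1 %/ 2) = 1)%g by apply: val_inj; rewrite FinRing.val_unitX.
  move/eqP; rewrite -order_dvdn og => /dvdn_leq; lia.
move=> x x0; have xU : x \is a GRing.unit by rewrite unitfE.
have : FinRing.unit F xU \in [set: {unit F}] by rewrite inE.
rewrite gE => /cycleP [i xi]; exists i.
by rewrite -[x]/(val (FinRing.unit F xU)) xi FinRing.val_unitX.
Qed.

(** Let q = #|F| and let g generate the cyclic unit group. Then g^((q-1)/2) is a square root of 1
    other than 1, hence -1, and 4 | q - 1 makes it the square of g^((q-1)/4). *)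
Lemma finField_sqrtN1 : (exists i : F, i ^+ 2 = -1) /\ -1 != 1 :> F.
Proof.
have [g [g0 g1 gP]] := finField_generator.
have F1 : (1 < #|F|)%N := finNzRing_gt1 F.
have gq : g ^+ (#|F|.-1) = 1.
  apply: (mulIf g0); rewrite mul1r -exprSr prednK ?expf_card //; lia.
have gN : g ^+ (#|F|.-1 %/ 2) = -1.
  apply/eqP; have : (g ^+ (#|F|.-1 %/ 2)) ^+ 2 == 1.
    by rewrite -exprM (_ : (_ * _ = #|F|.-1)%N) ?gq //; lia.
  by rewrite sqrf_eq1 (negPf g1).
split; last by rewrite -gN.
by exists (g ^+ (#|F|.-1 %/ 4)); rewrite -exprM -gN; congr (_ ^+ _); lia.
Qed.

Lemma finField_two_neq0 : 2 != 0 :> F.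
Proof.
have [_ h] := finField_sqrtN1; apply: contraNneq h => h.
by rewrite eq_sym -subr_eq0 opprK -[1 + 1]/(2%:R) h.
Qed.

Lemma finField_opp_neq (x : F) : x != 0 -> - x != x.
Proof.
by move=> x0; rewrite -subr_eq0 -opprD oppr_eq0 -mulr2n -mulr_natr mulf_neq0 ?finField_two_neq0.
Qed.

Definition qchi (x : F) : int :=
  if x == 0 then 0 else if [exists y, x == y ^+ 2] then 1 else -1.

Lemma qchi0 : qchi 0 = 0.
Proof. by rewrite /qchi eqxx. Qed.

Lemma qchi_sq x : x != 0 -> qchi (x ^+ 2) = 1.
Proof.
move=> x0; rewrite /qchi sqrf_eq0 (negPf x0).
by case: existsP => // -[]; exists x.
Qed.

Lemma qchi1 : qchi 1 = 1.
Proof. by rewrite -(qchi_sq (oner_neq0 F)) expr1n. Qed.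

Lemma qchiN1 : qchi (-1) = 1.
Proof.
have [[i iE] _] := finField_sqrtN1; rewrite -iE; apply: qchi_sq.
apply: contraTneq (oner_neq0 F) => i0.
by rewrite -[1]opprK -iE i0 expr0n oppr0 eqxx.
Qed.

Lemma qchi_eq0 x : (qchi x == 0) = (x == 0).
Proof. by rewrite /qchi; case: (x == 0) => //; case: ifP. Qed.

(** Nonsquares are odd powers of a generator, so a product of two is an even power. *)
Lemma qchi_nonsq x y : qchi x = -1 -> qchi y = -1 -> qchi (x * y) = 1.
Proof.
have [g [g0 _ gP]] := finField_generator.
have odd_exp z : qchi z = -1 -> exists k, z = g ^+ (k.*2.+1).
  move=> zN; have z0 : z != 0 by rewrite -qchi_eq0 zN.
  have [i zi] := gP _ z0.
  have := odd_double_half i; case: (odd i) => iE; first by exists i./2; rewrite zi -{1}iE.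
  by move: zN; rewrite zi -iE add0n -muln2 exprM qchi_sq ?expf_neq0.
move=> /odd_exp[k ->] /odd_exp[l ->].
rewrite -exprD (_ : (_ + _ = (k + l).+1 * 2)%N) ?exprM ?qchi_sq ?expf_neq0 //; lia.
Qed.

Lemma qchiP x : x != 0 -> (exists2 y, y != 0 & x = y ^+ 2) \/ qchi x = -1.
Proof.
move=> x0; rewrite /qchi (negPf x0).
case: existsP => [[y /eqP xy]|_]; last by right.
by left; exists y => //; apply: contraNneq x0 => y0; rewrite xy y0 expr0n.
Qed.

Lemma qchi_sqM c x : c != 0 -> qchi (c ^+ 2 * x) = qchi x.
Proof.
move=> c0; rewrite /qchi mulf_eq0 sqrf_eq0 (negPf c0) /=.
case: eqP => // _; congr (if _ then _ else _).
apply/existsP/existsP => -[y /eqP xy].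
  exists (y / c); rewrite expr_div_n -xy mulrAC divff ?mul1r //.
  by rewrite sqrf_eq0.
by exists (c * y); rewrite xy exprMn.
Qed.

Lemma qchiM : {morph qchi : x y / x * y}.
Proof.
move=> x y; have [->|x0] := eqVneq x 0; first by rewrite !(mul0r, qchi0).
have [->|y0] := eqVneq y 0; first by rewrite !(mulr0, qchi0).
case: (qchiP x0) => [[c c0 ->]|xN]; first by rewrite qchi_sqM ?qchi_sq ?mul1r.
case: (qchiP y0) => [[c c0 ->]|yN]; first by rewrite mulrC qchi_sqM ?qchi_sq ?mulr1.
by rewrite qchi_nonsq // xN yN.
Qed.

Lemma qchiN x : qchi (- x) = qchi x.
Proof. by rewrite -mulN1r qchiM qchiN1 mul1r. Qed.

Lemma qchi_sqr x : qchi x ^+ 2 = (x != 0)%:R.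
Proof. by rewrite /qchi; case: (x == 0) => //; case: ifP. Qed.

Lemma qchi_cube x : qchi x ^+ 3 = qchi x.
Proof. by rewrite /qchi; case: (x == 0) => //; case: ifP. Qed.

(** Otherwise squaring, a surjection of a finite set onto itself, would be injective, although 1 and
    -1 have the same square. *)
Lemma qchi_nonsq_ex : exists r, qchi r = -1.
Proof.
have [_ N1] := finField_sqrtN1.
case: (boolP [exists r, qchi r == -1]) => [/existsP [r /eqP rN]|]; first by exists r.
rewrite negb_exists => /forallP h.
have sq_surj (x : F) : exists y, y ^+ 2 = x.
  have [->|x0] := eqVneq x 0; first by exists 0; rewrite expr0n.
  by have [[y _ ->]|xN] := qchiP x0; [exists y | have := h x; rewrite xN eqxx].
have sq_inj : injective (fun x : F => x ^+ 2).
  suff /image_injP inj : #|image (fun x : F => x ^+ 2) F| == #|F|.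
    by move=> x y; apply: inj.
  apply/eqP/eq_card => x; apply/imageP; have [y <-] := sq_surj x.
  by exists y.
by move/eqP: N1; case; apply: sq_inj; rewrite sqrrN.
Qed.

Lemma sum_qchi : \sum_x qchi x = 0.
Proof.
have [r rN] := qchi_nonsq_ex.
have r0 : r != 0 by rewrite -qchi_eq0 rN.
have : \sum_x qchi x = - \sum_x qchi x.
  rewrite {1}(reindex_inj (mulfI r0)) -sumrN; apply: eq_bigr => x _.
  by rewrite qchiM rN mulN1r.
lia.
Qed.

Lemma sum_qchi_sub c : \sum_x qchi (x - c) = 0.
Proof. by rewrite -[RHS]sum_qchi [RHS](reindex_inj (addIr (- c))). Qed.

Lemma sum_delta (V : pzRingType) (G : F -> V) c : \sum_x (x == c)%:R * G x = G c.
Proof.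
rewrite (bigD1 c) //= eqxx mul1r big1 ?addr0 // => x /negPf->.
by rewrite mul0r.
Qed.

(** For x != 0, replacing x by 1/x and dropping the square x^(-2) turns x (x + c) into 1 + c x. The
    sum of [qchi (1 + c * x)] over all x is 0, and its term at x = 0 is 1. *)
Lemma sum_qchi_shift c : c != 0 -> \sum_x qchi (x * (x + c)) = -1.
Proof.
move=> c0; rewrite (bigD1 0) //= mul0r qchi0 add0r.
have -> : \sum_(x | x != 0) qchi (x * (x + c)) = \sum_(x | x != 0) qchi (1 + c * x).
  rewrite (reindex_inj invr_inj) /=; apply: eq_big => x; first by rewrite invr_eq0.
  rewrite invr_eq0 => x0.
  have -> : x^-1 * (x^-1 + c) = (x^-1) ^+ 2 * (1 + c * x) by field.
  by rewrite qchi_sqM ?invr_eq0.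
have : \sum_x qchi (1 + c * x) = 0.
  rewrite -[RHS]sum_qchi [RHS](reindex_inj (addrI 1)) [RHS](reindex_inj (mulfI c0)).
  by [].
by rewrite (bigD1 0) //= mulr0 addr0 qchi1 => /eqP; rewrite addrC addr_eq0 => /eqP.
Qed.

Lemma sum_qchi_quad a b :
  \sum_x qchi ((x - a) * (x - b)) = #|F|%:Z * (a == b)%:R - 1.
Proof.
rewrite (reindex_inj (addIr a)) /=.
have [->|ab] := eqVneq a b; last first.
  rewrite mulr0 sub0r -(@sum_qchi_shift (a - b)) ?subr_eq0 //.
  by apply: eq_bigr => x _; congr qchi; ring.
rewrite mulr1 (bigD1 0) //= add0r subrr mul0r qchi0 add0r.
under eq_bigr => x x0 do rewrite addrK -expr2 qchi_sq //.
rewrite sumr_const cardC1 -subn1 natrB ?natz //.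
exact: (ltnW (finNzRing_gt1 F)).
Qed.

(** Each y has exactly 1 + [qchi y] square roots; for a nonzero square c^2 they are c and -c,
    distinct since 2 != 0. *)
Lemma sum_comp_sq (G : F -> int) : \sum_x G (x ^+ 2) = \sum_x (1 + qchi x) * G x.
Proof.
rewrite (partition_big (fun x => x ^+ 2) predT) //=; apply: eq_bigr => y _.
have [->|y0] := eqVneq y 0.
  rewrite qchi0 addr0 mul1r (bigD1 0) ?expr0n //= big1 ?addr0 // => x.
  by rewrite sqrf_eq0 => /andP[/eqP->]; rewrite eqxx.
have [[c c0 ->]|yN] := qchiP y0; last first.
  rewrite yN subrr mul0r big1 // => x /eqP xy.
  by move: yN; rewrite -xy qchi_sq //; apply: contraNneq y0 => x0; rewrite -xy x0 expr0n.
have Nc := finField_opp_neq c0.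
rewrite qchi_sq // (bigD1 c) //= (bigD1 (- c)) /= ?sqrrN ?eqxx //.
rewrite big1 ?addr0; first ring.
move=> x; rewrite eqf_sqr => /andP[/andP[/orP[]/eqP->]]; first by rewrite eqxx.
by move=> _; rewrite eqxx.
Qed.

Lemma sum_const (c : int) : \sum_(x : F) c = #|F|%:Z * c.
Proof. by rewrite sumr_const -mulr_natl natz. Qed.

Lemma sum_qchi_sqr : \sum_x qchi x ^+ 2 = #|F|%:Z - 1.
Proof.
have <- : \sum_(x : F) (1 - (x == 0)%:R * 1) = #|F|%:Z - 1.
  by rewrite sumrB sum_const (sum_delta (fun=> 1)) mulr1.
by apply: eq_bigr => x _; rewrite qchi_sqr; case: eqP.
Qed.

(** * Jacobsthal sums *)

(** The Jacobsthal sum J(r): the curve y^2 = x^3 - r x has #|F| + J(r) affine points. *)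
Definition jacobsthal (r : F) : int := \sum_x qchi (x * (x ^+ 2 - r)).

Lemma jacobsthal_sqM t r : t != 0 -> jacobsthal (t ^+ 2 * r) = qchi t * jacobsthal r.
Proof.
move=> t0; rewrite /jacobsthal (reindex_inj (mulfI t0)) mulr_sumr.
apply: eq_bigr => x _; rewrite -qchiM -[RHS](qchi_sqM _ t0); congr qchi; ring.
Qed.

Lemma jacobsthal0 : jacobsthal 0 = 0.
Proof.
rewrite -[RHS]sum_qchi; apply: eq_bigr => x _.
have [->|x0] := eqVneq x 0; first by rewrite mul0r.
by rewrite subr0 mulrC qchi_sqM.
Qed.

(** By scaling, J(r)^2 depends only on the class of r modulo nonzero squares. The right-hand side
    interpolates 2 J(r)^2 at chi(r) = 1, -1 and 0. *)
Lemma jacobsthal_sqr n r : qchi n = -1 ->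
  2 * jacobsthal r ^+ 2 =
    qchi r ^+ 2 * (jacobsthal 1 ^+ 2 + jacobsthal n ^+ 2)
    + qchi r * (jacobsthal 1 ^+ 2 - jacobsthal n ^+ 2).
Proof.
move=> nN; have n0 : n != 0 by rewrite -qchi_eq0 nN.
have [->|r0] := eqVneq r 0; first by rewrite jacobsthal0 qchi0; ring.
have [[c c0 ->]|rN] := qchiP r0.
  rewrite qchi_sq // -{1}[c ^+ 2]mulr1 jacobsthal_sqM // exprMn qchi_sqr c0 /=.
  ring.
(* Two nonsquares multiply to a square c^2, which puts r in the class of n. *)
have [[c c0 rE]|] := qchiP (mulf_neq0 r0 n0); last by rewrite qchi_nonsq.
have -> : r = (c / n) ^+ 2 * n by rewrite expr_div_n -rE; field.
have cn0 : c / n != 0 by rewrite mulf_neq0 ?invr_eq0.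
rewrite jacobsthal_sqM // qchi_sqM // nN exprMn qchi_sqr cn0 /=; ring.
Qed.

Lemma jacobsthal_sqrM (r : F) :
  jacobsthal r ^+ 2 = \sum_x \sum_y qchi (x * y * ((r - x ^+ 2) * (r - y ^+ 2))).
Proof.
rewrite expr2 /jacobsthal mulr_suml; apply: eq_bigr => x _.
rewrite mulr_sumr; apply: eq_bigr => y _; rewrite -qchiM; congr qchi; ring.
Qed.

(** Summing over r first gives q [x^2 = y^2] - 1 for each pair x, y. The -1 disappears in the sum
    over y, and each x != 0 keeps the two solutions y = x and y = -x. *)
Lemma sum_jacobsthal_sqr :
  \sum_r jacobsthal r ^+ 2 = 2 * #|F|%:Z * (#|F|%:Z - 1).
Proof.
under eq_bigr => r _ do rewrite jacobsthal_sqrM.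
rewrite exchange_big /=.
have inner x : \sum_r \sum_y qchi (x * y * ((r - x ^+ 2) * (r - y ^+ 2)))
    = #|F|%:Z * 2 * qchi x ^+ 2.
  rewrite exchange_big /=.
  have -> : \sum_y \sum_r qchi (x * y * ((r - x ^+ 2) * (r - y ^+ 2)))
      = \sum_y (#|F|%:Z * (qchi x * (qchi y * (x ^+ 2 == y ^+ 2)%:R)) - qchi x * qchi y).
    apply: eq_bigr => y _.
    under eq_bigr => r _ do rewrite qchiM.
    by rewrite -mulr_sumr sum_qchi_quad qchiM; ring.
  rewrite sumrB -!mulr_sumr sum_qchi mulr0 subr0 -mulrA; congr (_ * _).
  have [->|x0] := eqVneq x 0; first by rewrite qchi0 !mul0r mulr0.
  have Nx := finField_opp_neq x0.
  rewrite (bigD1 x) //= (bigD1 (- x)) //= sqrrN eqxx big1 ?addr0; last first.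
    by move=> y /andP[/negPf yx /negPf yNx]; rewrite eqf_sqr eq_sym yx -eqr_oppLR eq_sym yNx mulr0.
  rewrite qchiN /=; ring.
by rewrite (eq_bigr _ (fun x _ => inner x)) -mulr_sumr sum_qchi_sqr; ring.
Qed.

Lemma card_sub1_neq0 : #|F|%:Z - 1 != 0.
Proof. by have : (1 < #|F|)%N := finNzRing_gt1 F; lia. Qed.

(** Summing [jacobsthal_sqr] over r kills the term linear in chi(r); then q - 1 cancels. *)
Lemma jacobsthal_two_squares n : qchi n = -1 ->
  jacobsthal 1 ^+ 2 + jacobsthal n ^+ 2 = 4 * #|F|%:Z.
Proof.
move=> nN; apply: (mulfI card_sub1_neq0).
have : 2 * \sum_r jacobsthal r ^+ 2
    = (#|F|%:Z - 1) * (jacobsthal 1 ^+ 2 + jacobsthal n ^+ 2).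
  rewrite mulr_sumr; under eq_bigr => r _ do rewrite (jacobsthal_sqr _ nN).
  by rewrite big_split /= -!mulr_suml sum_qchi sum_qchi_sqr mul0r addr0.
by rewrite sum_jacobsthal_sqr => <-; ring.
Qed.

(** * The sum U and its value in Jacobsthal sums *)

Definition inversion_sum : int := \sum_x \sum_u qchi (x * u * (x - u) * (1 - x * u)).

(** With J(r)^2 expanded over x and y, each y != 0 contributes exactly U and y = 0 contributes
    nothing. *)
Lemma sum_qchi_jacobsthal_sqr :
  \sum_r qchi r * jacobsthal r ^+ 2 = (#|F|%:Z - 1) * inversion_sum.
Proof.
have sumE r : qchi r * jacobsthal r ^+ 2
    = \sum_y \sum_x qchi (r * (x * y * ((r - x ^+ 2) * (r - y ^+ 2)))).
  rewrite jacobsthal_sqrM exchange_big mulr_sumr; apply: eq_bigr => y _.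
  by rewrite mulr_sumr; apply: eq_bigr => x _; rewrite -qchiM.
rewrite (eq_bigr _ (fun r _ => sumE r)).
rewrite exchange_big /= (bigD1 0) //= big1 ?add0r; last first.
  by move=> r _; rewrite big1 // => x _; rewrite mulr0 mul0r mulr0 qchi0.
rewrite (eq_bigr (fun=> inversion_sum)).
  rewrite sumr_const cardC1 -mulr_natl -subn1 natrB ?natz //.
  exact: (ltnW (finNzRing_gt1 F)).
(* Scaling r by y^2 and x by y, and then putting r = x u, leaves the summand of U times the square
   of y^4 x. *)
move=> y y0; rewrite (reindex_inj (mulfI (expf_neq0 2 y0))) /=.
under eq_bigr => r _ do rewrite (reindex_inj (mulfI y0)).
rewrite exchange_big; apply: eq_bigr => x _ /=.
have [->|x0] := eqVneq x 0.
  by rewrite !big1 // => u _; rewrite ?mulr0 !mul0r ?mulr0 qchi0.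
rewrite (reindex_inj (mulfI x0)) /=; apply: eq_bigr => u _.
rewrite -[RHS](@qchi_sqM (y ^+ 4 * x)) ?mulf_neq0 ?expf_neq0 //.
by congr qchi; ring.
Qed.

(** Multiplying [jacobsthal_sqr] by chi(r) exchanges the roles of sum and difference, since chi^3 =
    chi; only the difference survives summation over r. *)
Lemma inversion_sum_jacobsthal n : qchi n = -1 ->
  2 * inversion_sum = jacobsthal 1 ^+ 2 - jacobsthal n ^+ 2.
Proof.
move=> nN; apply: (mulfI card_sub1_neq0).
rewrite mulrCA -sum_qchi_jacobsthal_sqr mulr_sumr.
have sumE r : 2 * (qchi r * jacobsthal r ^+ 2)
    = qchi r * (jacobsthal 1 ^+ 2 + jacobsthal n ^+ 2)
      + qchi r ^+ 2 * (jacobsthal 1 ^+ 2 - jacobsthal n ^+ 2).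
  rewrite mulrCA (jacobsthal_sqr _ nN) mulrDr !mulrA; congr (_ * _ + _ * _).
  by rewrite -[RHS]qchi_cube; ring.
rewrite (eq_bigr _ (fun r _ => sumE r)) big_split /= -!mulr_suml.
by rewrite sum_qchi_sqr sum_qchi mul0r add0r.
Qed.

(** * The sum T and its equality with U *)

Definition clique_sum : int :=
  \sum_x \sum_y qchi (x * y * (x - 1) * (y - 1) * (x - y)).

(** Passing from m^2, w^2 to M, W introduces the weight (1 + chi(M)) (1 + chi(W)). Of its four
    terms, 1 contributes 0, chi(M) and chi(W) contribute 1 each, and chi(M) chi(W) gives T. *)
Lemma sum_squared_differences :
  \sum_m \sum_w qchi ((m ^+ 2 - 1) * (w ^+ 2 - 1) * (m ^+ 2 - w ^+ 2))
  = clique_sum + 2.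
Proof.
pose t M W := qchi ((M - 1) * (W - 1) * (M - W)).
have tC M W : t W M = t M W by rewrite -[LHS]qchiN; congr qchi; ring.
have sum_t M : \sum_W t M W = - qchi (M - 1).
  have tE W : t M W = qchi (M - 1) * qchi ((W - 1) * (W - M)).
    by rewrite -qchiM -[LHS]qchiN; congr qchi; ring.
  rewrite (eq_bigr _ (fun W _ => tE W)) -mulr_sumr sum_qchi_quad.
  have [->|_] := eqVneq 1 M; first by rewrite subrr qchi0; ring.
  by rewrite mulr0; ring.
have -> : \sum_m \sum_w qchi ((m ^+ 2 - 1) * (w ^+ 2 - 1) * (m ^+ 2 - w ^+ 2))
    = \sum_M (1 + qchi M) * (\sum_W (1 + qchi W) * t M W).
  rewrite -(sum_comp_sq (fun M => \sum_W (1 + qchi W) * t M W)).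
  by apply: eq_bigr => m _; rewrite -(sum_comp_sq (t (m ^+ 2))).
have -> : \sum_M (1 + qchi M) * (\sum_W (1 + qchi W) * t M W)
    = \sum_M \sum_W t M W + \sum_M \sum_W qchi W * t M W
      + \sum_M qchi M * (\sum_W t M W) + \sum_M \sum_W qchi M * qchi W * t M W.
  rewrite -!big_split; apply: eq_bigr => M _ /=.
  have -> : \sum_W (1 + qchi W) * t M W = \sum_W t M W + \sum_W qchi W * t M W.
    by rewrite -big_split; apply: eq_bigr => W _ /=; ring.
  have -> : \sum_W qchi M * qchi W * t M W = qchi M * \sum_W qchi W * t M W.
    by rewrite mulr_sumr; apply: eq_bigr => W _; rewrite mulrA.
  ring.
have one : \sum_M qchi M * (\sum_W t M W) = 1.
  have tE M : qchi M * (\sum_W t M W) = - qchi (M * (M - 1)).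
    by rewrite sum_t mulrN qchiM.
  rewrite (eq_bigr _ (fun M _ => tE M)) sumrN sum_qchi_shift ?opprK //.
  by rewrite oppr_eq0 oner_neq0.
have -> : \sum_M \sum_W t M W = 0.
  by rewrite (eq_bigr _ (fun M _ => sum_t M)) sumrN sum_qchi_sub oppr0.
have -> : \sum_M \sum_W qchi W * t M W = 1.
  rewrite exchange_big -one; apply: eq_bigr => M _ /=.
  by rewrite mulr_sumr; apply: eq_bigr => W _; rewrite tC.
rewrite one (_ : \sum_M \sum_W qchi M * qchi W * t M W = clique_sum); first ring.
apply: eq_bigr => M _; apply: eq_bigr => W _.
by rewrite -!qchiM; congr qchi; ring.
Qed.

(* The Cayley transform m |-> (1 + m) / (1 - m) = -1 + 2 / (1 - m); because
   0^-1 = 0 it is a bijection of F, with 1 sent to -1, and the summands with an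
   argument equal to -1 account for the constant. *)
Lemma sum_squared_differences_inversion :
  \sum_m \sum_w qchi ((m ^+ 2 - 1) * (w ^+ 2 - 1) * (m ^+ 2 - w ^+ 2))
  = inversion_sum + 2.
Proof.
pose c (m : F) := -1 + 2 * (1 - m)^-1.
pose g x u := qchi (x * u * (x - u) * (1 - x * u)).
have two0 := finField_two_neq0.
have c_inj : injective c.
  by move=> m w /addrI /(mulfI two0) /invr_inj /addrI /oppr_inj.
have c1 : c 1 = -1 by rewrite /c subrr invr0 mulr0 addr0.
have gC x u : g u x = g x u by rewrite -[LHS]qchiN; congr qchi; ring.
(* At x = -1 the argument of the character is u (u + 1)^2, so the sum is that of chi(u) over u !=
   -1. *)
have gN1 : \sum_u g (-1) u = -1.
  rewrite (bigD1 (-1)) //= /g subrr mulr0 mul0r qchi0 add0r.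
  have gE u : u != -1 -> qchi (-1 * u * (-1 - u) * (1 - -1 * u)) = qchi u.
    move=> u1; rewrite -[RHS](@qchi_sqM (u + 1)); first by congr qchi; ring.
    by rewrite addr_eq0.
  rewrite (eq_bigr _ gE); have := sum_qchi; rewrite (bigD1 (-1)) //= qchiN1.
  by move/eqP; rewrite addrC addr_eq0 => /eqP.
(* For m = 1 or w = 1 the character on the right vanishes and the indicator terms supply the left
   side; m = w = 1 does no harm because g (-1) (-1) = 0. *)
have gcE m w : g (c m) (c w) = qchi ((m ^+ 2 - 1) * (w ^+ 2 - 1) * (m ^+ 2 - w ^+ 2))
    + (m == 1)%:R * g (-1) (c w) + (w == 1)%:R * g (c m) (-1).
  have gNN : g (-1) (-1) = 0 by rewrite /g subrr mulr0 mul0r qchi0.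
  have [->|m1] := eqVneq m 1.
    rewrite c1 expr1n subrr !mul0r qchi0 /=.
    by have [->|_] := eqVneq w 1; rewrite ?c1 ?gNN /=; ring.
  have [->|w1] := eqVneq w 1.
    by rewrite c1 expr1n subrr mulr0 !mul0r qchi0 /=; ring.
  rewrite !mul0r !addr0; have m10 : 1 - m != 0 by rewrite subr_eq0 eq_sym.
  have w10 : 1 - w != 0 by rewrite subr_eq0 eq_sym.
  (* Clearing denominators of the transformed argument leaves, up to sign, the square of this
     factor. *)
  rewrite -qchiN -[RHS](@qchi_sqM (2 / ((1 - m) ^+ 2 * (1 - w) ^+ 2))).
    by rewrite /g /c; congr qchi; field; rewrite m10 w10.
  by rewrite mulf_neq0 ?invr_eq0 ?mulf_neq0 ?expf_neq0.
have -> : inversion_sum = \sum_m \sum_w g (c m) (c w).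
  rewrite {1}/inversion_sum (reindex_inj c_inj); apply: eq_bigr => m _.
  by rewrite (reindex_inj c_inj).
have -> : \sum_(m : F) \sum_(w : F) g (c m) (c w)
    = \sum_m \sum_w qchi ((m ^+ 2 - 1) * (w ^+ 2 - 1) * (m ^+ 2 - w ^+ 2))
    + \sum_(m : F) (m == 1)%:R * (\sum_w g (-1) (c w)) + \sum_m g (-1) (c m).
  rewrite -!big_split; apply: eq_bigr => m _ /=.
  rewrite mulr_sumr -[g (-1) (c m)]gC -(sum_delta (fun w => g (c m) (-1)) 1).
  by rewrite -!big_split; apply: eq_bigr => w _ /=; rewrite gcE.
have gcN1 : \sum_w g (-1) (c w) = -1 by rewrite -[RHS]gN1 [RHS](reindex_inj c_inj).
rewrite (sum_delta (fun=> \sum_w g (-1) (c w))) gcN1; ring.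
Qed.

Lemma clique_sum_jacobsthal n : qchi n = -1 ->
  clique_sum = 2 * #|F|%:Z - jacobsthal n ^+ 2.
Proof.
move=> nN; have /addIr -> : clique_sum + 2 = inversion_sum + 2.
  by rewrite -sum_squared_differences sum_squared_differences_inversion.
have := jacobsthal_two_squares nN; have := inversion_sum_jacobsthal nN; lia.
Qed.

(* h selects one element of each pair {x, -x}. *)
Lemma sum_even_half : exists h : pred F, forall G : F -> int,
  (forall x, G (- x) = G x) -> G 0 = 0 -> \sum_x G x = 2 * \sum_(x | h x) G x.
Proof.
(* The enumeration order decides between x and -x; 0, equal to its opposite, is left out. *)
exists (fun x => (enum_rank x < enum_rank (- x)%R)%N) => G GN G0.
have Nx (x : F) : x != 0 -> (enum_rank (- x) != enum_rank x :> nat).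
  by move=> x0; rewrite (inj_eq val_inj) (inj_eq enum_rank_inj) finField_opp_neq.
rewrite (bigID (fun x => (enum_rank x < enum_rank (- x)%R)%N)) /=.
rewrite [X in _ + X](_ : _ = \sum_(x | (enum_rank x < enum_rank (- x)%R)%N) G x); first ring.
rewrite (reindex_inj oppr_inj) [LHS]big_mkcond [RHS]big_mkcond; apply: eq_bigr => x _ /=.
rewrite opprK GN; have [->|x0] := eqVneq x 0; first by rewrite oppr0 ltnn G0.
by rewrite -leqNgt leq_eqVlt eq_sym (negPf (Nx _ x0)).
Qed.

(** The summand is even in x and is 1 or -1 except at 0, 1, -1. Half of the field thus carries (q -
    3)/2 such values, an odd number, so J(1) is twice an odd integer. *)
Lemma jacobsthal1_mod4 : exists k, jacobsthal 1 = 4 * k + 2.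
Proof.
have [h hP] := sum_even_half.
pose G x := qchi (x * (x ^+ 2 - 1)).
have GN x : G (- x) = G x by rewrite -[RHS]qchiN; congr qchi; ring.
have G0 : G 0 = 0 by rewrite /G mul0r qchi0.
have [_ N1] := finField_sqrtN1.
have G2 : \sum_x G x ^+ 2 = #|F|%:Z - 3.
  rewrite (_ : #|F|%:Z - 3 =
      \sum_(x : F) (1 - (x == 0)%:R * 1 - (x == 1)%:R * 1 - (x == -1)%:R * 1)).
    apply: eq_bigr => x _; rewrite qchi_sqr mulf_eq0 subr_eq0 sqrf_eq1.
    have [->|x0] := eqVneq x 0.
      by rewrite eq_sym oner_eq0 eq_sym oppr_eq0 oner_eq0 /=; ring.
    have [->|x1] := eqVneq x 1; first by rewrite eq_sym (negPf N1) /=; ring.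
    by case: eqP => _ /=; ring.
  by rewrite !sumrB !(sum_delta (fun=> 1)) sum_const; ring.
have G2h := hP (fun x => G x ^+ 2); rewrite G2 G0 /= in G2h.
have {}G2h := G2h (fun x => congr1 (fun z => z ^+ 2) (GN x)) erefl.
have Gh := hP G GN G0.
(* A sum of values 0, 1, -1 has the parity of the sum of their squares; e counts the values -1. *)
have [e eE] : exists e, \sum_(x | h x) G x ^+ 2 - \sum_(x | h x) G x = 2 * e.
  exists (\sum_(x | h x) (G x == -1)%:R).
  rewrite -sumrB mulr_sumr; apply: eq_bigr => x _.
  by rewrite /G /qchi; case: (_ == 0) => //; case: ifP.
rewrite /jacobsthal Gh.
have F1 : (1 < #|F|)%N := finNzRing_gt1 F.
exists ((\sum_(x | h x) G x - 1) %/ 2)%Z.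
move: (\sum_(x | h x) G x) (\sum_(x | h x) G x ^+ 2) G2h eE => A B.
by move: #|F| card_mod4 F1 => q; lia.
Qed.

(** * The common neighbourhood of 0 and 1 *)

(* 4 if x is adjacent to both 0 and 1 in the Paley graph, and 0 otherwise. *)
Definition edge_pair (x : F) : int :=
  (qchi x + qchi x ^+ 2) * (qchi (x - 1) + qchi (x - 1) ^+ 2).

(** Away from 0 and 1 the squares equal 1. At 0 and at 1 the four character terms add up to 2, which
    the indicators remove. *)
Lemma edge_pairE x : edge_pair x =
  1 + qchi x + qchi (x - 1) + qchi (x * (x - 1)) - 2 * (x == 0)%:R - 2 * (x == 1)%:R.
Proof.
rewrite /edge_pair qchiM !qchi_sqr subr_eq0.
have [->|x0] := eqVneq x 0.
  by rewrite sub0r qchiN qchi0 qchi1 eq_sym oner_eq0 /=; ring.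
have [->|x1] := eqVneq x 1; first by rewrite subrr qchi0 qchi1 /=; ring.
by rewrite /=; ring.
Qed.

(** [edge_pair] is supported where both characters are 1, so it absorbs them. *)
Lemma edge_pair_qchi x : edge_pair x * qchi x = edge_pair x.
Proof. by rewrite /edge_pair mulrAC mulrDl -expr2 -exprSr qchi_cube [X in X * _]addrC. Qed.

Lemma edge_pair_qchi1 x : edge_pair x * qchi (x - 1) = edge_pair x.
Proof.
rewrite /edge_pair -mulrA [X in _ * X]mulrDl -expr2 -exprSr qchi_cube.
by rewrite [X in _ * X]addrC.
Qed.

Lemma edge_pair_sqr x : edge_pair x ^+ 2 = 4 * edge_pair x.
Proof.
have sqrE y : (qchi y + qchi y ^+ 2) ^+ 2 = 2 * (qchi y + qchi y ^+ 2).
  have -> : (qchi y + qchi y ^+ 2) ^+ 2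
      = qchi y ^+ 2 + 2 * qchi y ^+ 3 + qchi y ^+ 3 * qchi y by ring.
  by rewrite qchi_cube; ring.
by rewrite /edge_pair exprMn !sqrE; ring.
Qed.

Lemma edge_pair01 x : edge_pair x * (x == 0)%:R = 0 /\ edge_pair x * (x == 1)%:R = 0.
Proof.
split; first by have [->|_] := eqVneq x 0; rewrite ?mulr0 // /edge_pair qchi0; ring.
by have [->|_] := eqVneq x 1; rewrite ?mulr0 // /edge_pair subrr qchi0; ring.
Qed.

Lemma sum_edge_pair : \sum_x edge_pair x = #|F|%:Z - 5.
Proof.
rewrite (eq_bigr _ (fun x _ => edge_pairE x)) !sumrB !big_split /=.
rewrite sum_const sum_qchi sum_qchi_sub sum_qchi_shift ?oppr_eq0 ?oner_neq0 //.
have sum2 c : \sum_(x : F) 2 * (x == c)%:R = 2 :> int.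
  under eq_bigr => x _ do rewrite mulrC.
  exact: (sum_delta (fun=> 2)).
by rewrite !sum2; ring.
Qed.

(** All products from [edge_pairE] are elementary except the cubic character sum kept on the
    right. *)
Lemma sum_edge_pair_qchi x :
  \sum_y edge_pair y * qchi (x - y) =
    #|F|%:Z * (x == 0)%:R + #|F|%:Z * (x == 1)%:R - 2 - 2 * qchi x - 2 * qchi (x - 1)
    + \sum_y qchi (y * (y - 1)) * qchi (x - y).
Proof.
have -> : \sum_y edge_pair y * qchi (x - y)
    = \sum_y qchi (y - x) + \sum_y qchi ((y - 0) * (y - x))
      + \sum_y qchi ((y - 1) * (y - x)) + \sum_y qchi (y * (y - 1)) * qchi (x - y)
      - \sum_y (y == 0)%:R * (2 * qchi (x - y)) - \sum_y (y == 1)%:R * (2 * qchi (x - y)).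
  rewrite -!big_split -!sumrB; apply: eq_bigr => y _ /=.
  by rewrite edge_pairE !qchiM subr0 -[y - x]opprB qchiN; ring.
rewrite sum_qchi_sub !sum_qchi_quad !sum_delta subr0 ![_ == x]eq_sym; ring.
Qed.

(** The part with chi(x - y) is reduced to T by expanding the two factors [edge_pair] in turn; the
    part with chi(x - y)^2 is the full double sum minus its diagonal. *)
Lemma sum_edge_pair_edge :
  \sum_x \sum_y edge_pair x * edge_pair y * (qchi (x - y) + qchi (x - y) ^+ 2)
  = #|F|%:Z ^+ 2 - 20 * #|F|%:Z + 81 + clique_sum.
Proof.
pose f := edge_pair; pose g x := qchi (x * (x - 1)).
(* Expand f y. The terms -2, -2 chi(x), -2 chi(x - 1) each act on f x as -2, giving -6, and f x
   kills the indicators. *)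
have Q1 : \sum_x \sum_y f x * f y * qchi (x - y)
    = -6 * (#|F|%:Z - 5) + \sum_x \sum_y f x * g y * qchi (x - y).
  rewrite -sum_edge_pair mulr_sumr -big_split; apply: eq_bigr => x _ /=.
  have -> : \sum_y f x * f y * qchi (x - y) = f x * \sum_y f y * qchi (x - y).
    by rewrite mulr_sumr; apply: eq_bigr => y _; rewrite mulrA.
  have -> : \sum_y f x * g y * qchi (x - y) = f x * \sum_y g y * qchi (x - y).
    by rewrite mulr_sumr; apply: eq_bigr => y _; rewrite mulrA.
  rewrite sum_edge_pair_qchi mulrDr; congr (_ + _).
  have [f0 f1] := edge_pair01 x.
  have fq := edge_pair_qchi x; have fq1 := edge_pair_qchi1 x.
  rewrite !mulrBr mulrDr !(mulrCA (f x)) f0 f1 fq fq1 /f; ring.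
(* Expand f x. The sum of -2 g contributes 2, and the corrections chi^2 = 1 - [y = 0] and its
   analogue at 1 contribute 2 each. *)
have Q2 : \sum_x \sum_y f x * g y * qchi (x - y) = 6 + clique_sum.
  rewrite exchange_big /=.
  have -> : 6 + clique_sum = \sum_y (-2 * g y - 2 * qchi (y - 1) + (y == 0)%:R * 2
      - 2 * qchi y + (y == 1)%:R * 2) + \sum_y \sum_x g x * g y * qchi (x - y).
    rewrite !big_split /= !sumrN -!mulr_sumr !(sum_delta (fun=> 2)).
    rewrite sum_qchi sum_qchi_sub sum_qchi_shift ?oppr_eq0 ?oner_neq0 //.
    congr (_ + _); rewrite exchange_big; apply: eq_bigr => x _; apply: eq_bigr => y _.
    by rewrite -!qchiM; congr qchi; ring.
  rewrite -big_split; apply: eq_bigr => y _ /=.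
  have -> : \sum_x f x * g y * qchi (x - y) = g y * \sum_x f x * qchi (y - x).
    rewrite mulr_sumr; apply: eq_bigr => x _.
    by rewrite -[y - x]opprB qchiN; ring.
  have -> : \sum_x g x * g y * qchi (x - y) = g y * \sum_x g x * qchi (y - x).
    rewrite mulr_sumr; apply: eq_bigr => x _.
    by rewrite -[y - x]opprB qchiN; ring.
  rewrite sum_edge_pair_qchi mulrDr; congr (_ + _).
  rewrite /g qchiM.
  have [->|y0] := eqVneq y 0.
    by rewrite qchi0 sub0r qchiN qchi1 eq_sym oner_eq0 /=; ring.
  have [->|y1] := eqVneq y 1; first by rewrite subrr qchi0 qchi1 /=; ring.
  have := qchi_sqr y; have := qchi_sqr (y - 1); rewrite subr_eq0 y0 y1 /= => h1 h0.
  rewrite !mulr0 !mul0r !addr0 !add0r.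
  have -> : qchi y * qchi (y - 1) * (- 2 - 2 * qchi y - 2 * qchi (y - 1))
    = -2 * (qchi y * qchi (y - 1)) - 2 * (qchi y ^+ 2) * qchi (y - 1)
      - 2 * qchi y * qchi (y - 1) ^+ 2 by ring.
  by rewrite h0 h1; ring.
have -> : \sum_x \sum_y edge_pair x * edge_pair y * (qchi (x - y) + qchi (x - y) ^+ 2)
    = \sum_x \sum_y f x * f y * qchi (x - y)
      + ((\sum_x f x) ^+ 2 - \sum_x f x ^+ 2).
  rewrite [(\sum_x f x) ^+ 2]expr2 mulr_suml -sumrB -big_split; apply: eq_bigr => x _ /=.
  have -> : f x ^+ 2 = \sum_y (y == x)%:R * (f x * f y) by rewrite sum_delta expr2.
  rewrite mulr_sumr -sumrB -big_split; apply: eq_bigr => y _ /=.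
  rewrite qchi_sqr subr_eq0 [x == y]eq_sym.
  by case: (y == x); rewrite /f /=; ring.
rewrite (eq_bigr _ (fun x _ => edge_pair_sqr x)) -mulr_sumr sum_edge_pair Q1 Q2.
by ring.
Qed.

End QuadraticCharacter.

(** * Sums of two squares and the value of T *)

(** Since (av - bu)(av + bu) = p (a^2 - u^2), p divides av - bu after a possible change of sign of
    b. From (av - bu)^2 + (au + bv)^2 = p^2 the quotient k satisfies k^2 <= 1, and parity makes k
    even, so av = bu. *)
Lemma two_squares_unique (p : nat) (a b u v : int) :
  prime p -> odd p -> p%:Z = a ^+ 2 + b ^+ 2 -> p%:Z = u ^+ 2 + v ^+ 2 ->
  (2 %| a)%Z -> (2 %| u)%Z -> a ^+ 2 = u ^+ 2.
Proof.
move=> p_pr p_odd pab puv a_even u_even.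
wlog: b pab / (p %| a * v - b * u)%Z.
  move=> wl; have : (p %| (a * v - b * u) * (a * v - (- b) * u))%Z.
    have -> : (a * v - b * u) * (a * v - (- b) * u) = p%:Z * (a ^+ 2 - u ^+ 2).
      by rewrite [RHS]mulrBr {1}puv pab; ring.
    exact: dvdz_mulr.
  rewrite dvdzE abszM Euclid_dvdM // => /orP[]; first exact: wl.
  by apply: (wl (- b)); rewrite sqrrN.
move=> /dvdzP [k kE].
have sumE : (a * v - b * u) ^+ 2 + (a * u + b * v) ^+ 2 = p%:Z ^+ 2.
  by rewrite [RHS]expr2 {1}pab puv; ring.
have av_even : (2 %| a * v - b * u)%Z by apply: rpredB; [apply: dvdz_mulr | apply: dvdz_mull].
have k0 : k = 0.
  have p_gt0 := prime_gt0 p_pr.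
  have k2 : (2 %| k)%Z.
    move: av_even; rewrite kE !dvdzE abszM /= Euclid_dvdM // => /orP[] //.
    by rewrite dvdn2 p_odd.
  have : k ^+ 2 * p%:Z ^+ 2 <= 1 * p%:Z ^+ 2.
    by rewrite mul1r -[X in _ <= X]sumE kE exprMn lerDl sqr_ge0.
  rewrite ler_pM2r ?exprn_gt0 // => k1.
  have /dvdzP [l lE] := k2; move: k1; rewrite lE; clear.
  have [l0|[->|l0]] : l <= -1 \/ l = 0 \/ 1 <= l by lia.
  - nia.
  - by [].
  - nia.
have av : a * v = b * u by apply/eqP; rewrite -subr_eq0 kE k0 mul0r.
have p0 : p%:Z != 0 by have := prime_gt0 p_pr; lia.
apply: (mulfI p0); rewrite {1}puv pab.
have : (a * v) ^+ 2 = (b * u) ^+ 2 by rewrite av.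
by rewrite !exprMn; lia.
Qed.

(** J(1)/2 is odd and the squares of J(1)/2 and J(n)/2 add up to p, so J(n)/2 is even and its square
    is a^2 by uniqueness. *)
Lemma clique_sum_two_squares (p : nat) (a b : int) :
  prime p -> (p = 1 %[mod 4])%N -> p%:Z = a ^+ 2 + b ^+ 2 -> (2 %| a)%Z ->
  clique_sum 'F_p = 2 * p%:Z - 4 * a ^+ 2.
Proof.
move=> p_pr p4 pab a_even.
have cF := card_Fp p_pr; have F4 : (#|'F_p| = 1 %[mod 4])%N by rewrite cF.
have [m pm] : exists m, p = (4 * m + 1)%N.
  by exists (p %/ 4)%N; rewrite {1}(divn_eq p 4) p4 mulnC.
have [n nN] := qchi_nonsq_ex F4.
rewrite (clique_sum_jacobsthal F4 nN) cF.
have [k kE] := jacobsthal1_mod4 F4.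
have := jacobsthal_two_squares F4 nN; rewrite cF kE.
set J := jacobsthal n => JE.
have even_sqr (x y : int) : x ^+ 2 = 2 * y -> (2 %| x)%Z.
  move=> xy; have : (2 %| x ^+ 2)%Z by rewrite xy dvdz_mulr.
  by rewrite !dvdzE abszX Euclid_dvdX // => /andP[].
have /dvdzP [v vE] : (2 %| J)%Z.
  apply: (even_sqr _ (2 * p%:Z - 2 * (2 * k + 1) ^+ 2)).
  have -> : J ^+ 2 = 4 * p%:Z - (4 * k + 2) ^+ 2 by rewrite -JE; ring.
  ring.
have puv : p%:Z = v ^+ 2 + (2 * k + 1) ^+ 2.
  by apply: (@mulfI _ 4) => //; rewrite -JE vE; ring.
have v_even : (2 %| v)%Z.
  apply: (even_sqr _ (2 * m%:Z - 2 * k ^+ 2 - 2 * k)).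
  have -> : v ^+ 2 = p%:Z - (2 * k + 1) ^+ 2 by rewrite puv; ring.
  rewrite pm PoszD PoszM; ring.
have p_odd : odd p by rewrite pm oddD oddM.
by rewrite (two_squares_unique p_pr p_odd pab puv a_even v_even) vE; ring.
Qed.

(** * Clique counts *)

Section CliqueCounting.

Variables (T : finType) (e : rel T).
Hypotheses (e_sym : symmetric e) (e_irr : irreflexive e).

(** The restriction to S lets the count recurse into neighbourhoods. *)
Definition cliques_in (S : {set T}) (m : nat) : {set {set T}} :=
  [set A : {set T} | [&& A \subset S, is_clique e A & #|A| == m]].

Lemma is_cliqueP (A : {set T}) :
  reflect {in A &, forall x y, x != y -> e x y} (is_clique e A).
Proof.
apply: (iffP forall_inP) => [h x y xA yA xy|h x xA].
  by move/forall_inP: (h x xA) => /(_ y yA) /implyP; apply.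
by apply/forall_inP => y yA; apply/implyP => xy; apply: h.
Qed.

Lemma is_cliqueU1 v (B : {set T}) : v \notin B ->
  is_clique e (v |: B) = is_clique e B && (B \subset [set w | e v w]).
Proof.
move=> vB; apply/is_cliqueP/andP => [h|[/is_cliqueP h /subsetP hv] x y].
  split; first by apply/is_cliqueP => x y xB yB; apply: h; rewrite inE ?xB ?yB orbT.
  apply/subsetP => w wB; rewrite inE; apply: h; rewrite ?inE ?eqxx ?wB ?orbT //.
  by apply: contraNneq vB => ->.
move=> /setU1P[->|xB] /setU1P[->|yB] xy.
- by rewrite eqxx in xy.
- by have := hv _ yB; rewrite inE.
- by have := hv _ xB; rewrite inE e_sym.
- exact: h.
Qed.

(** The bijection is B -> v |: B; irreflexivity keeps v out of its own neighbourhood. *)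
Lemma card_cliques_through (S : {set T}) m v : v \in S ->
  #|cliques_in (S :&: [set w | e v w]) m| =
  #|[set A in cliques_in S m.+1 | v \in A]|.
Proof.
move=> vS; rewrite -(@card_in_imset _ _ (fun B => v |: B)); last first.
  have notin B : B \in cliques_in (S :&: [set w | e v w]) m -> v \notin B.
    rewrite inE => /andP[/subsetP BS _]; apply/negP => /BS.
    by rewrite !inE e_irr andbF.
  move=> B C /notin vB /notin vC BC.
  by rewrite -(setU1K vB) BC setU1K.
apply: eq_card => A; apply/imsetP/idP => [[B]|].
  rewrite inE subsetI => /and3P[/andP[BS Bv] Bcl /eqP Bm] ->.
  have vB : v \notin B by apply/negP => /(subsetP Bv); rewrite inE e_irr.
  rewrite !inE eqxx /= andbT subUset sub1set vS BS is_cliqueU1 // Bcl Bv.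
  by rewrite cardsU1 vB Bm eqxx.
rewrite !inE => /andP[/and3P[AS Acl /eqP Am] vA].
exists (A :\ v); last by rewrite setD1K.
move: Acl; rewrite -{1}(setD1K vA) is_cliqueU1 ?setD11 // => /andP[Bcl Bv].
rewrite inE subsetI Bv Bcl (subset_trans (subsetDl _ _) AS) /=.
by move: Am; rewrite (cardsD1 v) vA add1n => -[->].
Qed.

(** Double counting of the pairs (v, A) with v in the clique A. *)
Lemma card_cliques_inS (S : {set T}) m :
  (m.+1 * #|cliques_in S m.+1| =
   \sum_(v in S) #|cliques_in (S :&: [set w | e v w]) m|)%N.
Proof.
rewrite (eq_bigr _ (fun v vS => card_cliques_through m vS)).
under eq_bigr => v _ do rewrite -sum1dep_card.
rewrite (exchange_big_dep (mem (cliques_in S m.+1))) /=; last by move=> v A _ /andP[].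
rewrite mulnC -sum_nat_const; apply: eq_bigr => A.
rewrite inE => /and3P[AS Acl /eqP <-].
rewrite -sum1_card; apply: eq_bigl => v.
rewrite AS Acl eqxx; case vA : (v \in A); last by rewrite !andbF.
by rewrite (subsetP AS).
Qed.

Lemma card_cliques_in0 (S : {set T}) : #|cliques_in S 0| = 1%N.
Proof.
rewrite -(cards1 (set0 : {set T})); apply: eq_card => A; rewrite !inE cards_eq0.
have [->|_] := eqVneq A set0; last by rewrite !andbF.
by rewrite sub0set andbT; apply/is_cliqueP => x y; rewrite inE.
Qed.

(** For irreflexive [e] the adjacencies force the four vertices to be distinct. *)
Definition ordered_cliques4 : nat := (\sum_x \sum_y \sum_z \sum_w
  (e x y * e x z * e x w * e y z * e y w * e z w))%N.

Lemma num_cliques4 : (24 * num_cliques e 4 = ordered_cliques4)%N.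
Proof.
have -> : num_cliques e 4 = #|cliques_in setT 4|.
  by apply: eq_card => A; rewrite !inE subsetT.
rewrite -[24%N]/(2 * 3 * 4)%N -mulnA card_cliques_inS.
rewrite big_distrr /=; apply: eq_big => [x|x _]; first by rewrite inE.
rewrite setTI -mulnA card_cliques_inS.
rewrite big_distrr big_mkcond /=; apply: eq_bigr => y _.
rewrite inE; case: (e x y); last by rewrite big1 // => z _; rewrite big1.
rewrite card_cliques_inS big_mkcond /=; apply: eq_bigr => z _.
rewrite !inE; case: (e x z); last by rewrite /= big1.
case: (e y z); last by rewrite /= big1 // => w _; rewrite muln0.
(* The factor 1 completes 24 = 4 * 3 * 2 * 1 for the last vertex. *)
rewrite /= -[LHS]mul1n card_cliques_inS big_mkcond; apply: eq_bigr => w _ /=.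
rewrite card_cliques_in0 !inE.
by case: (e x w); case: (e y w); case: (e z w).
Qed.

End CliqueCounting.

(** * Ordered 4-cliques of the Paley graph of a finite field *)

Section PaleyField.

Variable F : finFieldType.
Hypothesis card_mod4 : (#|F| = 1 %[mod 4])%N.

Definition paley_rel : rel F := fun x y => qchi (x - y) == 1.

Definition sqi (x : F) : int := (qchi x == 1)%:R.

Lemma sqiE x : 2 * sqi x = qchi x + qchi x ^+ 2.
Proof. by rewrite /sqi /qchi; case: (x == 0) => //; case: ifP. Qed.

Lemma sqiN x : sqi (- x) = sqi x.
Proof. by rewrite /sqi qchiN. Qed.

(** The factor [sqi y] restricts to nonzero squares y, and multiplying by these preserves [sqi]. *)
Lemma sqiM y x : sqi y * sqi (y * x) = sqi y * sqi x.
Proof.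
rewrite /sqi qchiM //; case: eqP => [->|_]; last by rewrite !mul0r.
by rewrite !mul1r.
Qed.

Definition paley_edges : int :=
  \sum_x \sum_y sqi x * sqi y * sqi (x - 1) * sqi (y - 1) * sqi (x - y).

(** 32 = 2^5: each of the five indicators is half of chi + chi^2. *)
Lemma paley_edgesE : 32 * paley_edges = #|F|%:Z ^+ 2 - 20 * #|F|%:Z + 81 + clique_sum F.
Proof.
rewrite -sum_edge_pair_edge // /paley_edges mulr_sumr; apply: eq_bigr => x _.
rewrite mulr_sumr; apply: eq_bigr => y _; rewrite /edge_pair -!sqiE; ring.
Qed.

Lemma sum_sqi : 2 * \sum_x sqi x = #|F|%:Z - 1.
Proof.
rewrite mulr_sumr (eq_bigr _ (fun x _ => sqiE x)) big_split /=.
by rewrite sum_qchi // sum_qchi_sqr add0r.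
Qed.

(** An affine map with nonzero square slope moves the first two vertices to 0 and 1. There are q
    choices for the first vertex and as many differences as nonzero squares. *)
Lemma ordered_cliques4_paley :
  (ordered_cliques4 paley_rel)%:Z = #|F|%:Z * (\sum_x sqi x) * paley_edges.
Proof.
have -> : (ordered_cliques4 paley_rel)%:Z = \sum_x \sum_y \sum_z \sum_w
    sqi (x - y) * sqi (x - z) * sqi (x - w) * sqi (y - z) * sqi (y - w) * sqi (z - w).
  rewrite -natz natr_sum; apply: eq_bigr => x _.
  rewrite natr_sum; apply: eq_bigr => y _.
  rewrite natr_sum; apply: eq_bigr => z _.
  by rewrite natr_sum; apply: eq_bigr => w _; rewrite !natrM.
rewrite -mulrA -sum_const; apply: eq_bigr => x _.
rewrite (reindex_inj (addrI x)) mulr_suml; apply: eq_bigr => y _ /=.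
have [y0|y0] := eqVneq y 0.
  rewrite y0 addr0 subrr /sqi qchi0 eq_sym oner_eq0 mul0r big1 // => z _.
  by rewrite big1 // => w _; rewrite !mul0r.
(* Write the third and fourth vertices as x + y z and x + y w. *)
rewrite (reindex_inj (addrI x)) (reindex_inj (mulfI y0)) mulr_sumr.
apply: eq_bigr => z _ /=.
rewrite (reindex_inj (addrI x)) (reindex_inj (mulfI y0)) mulr_sumr.
apply: eq_bigr => w _ /=.
have subE (s t : F) : x + s - (x + t) = s - t by ring.
have sub0E (s : F) : x - (x + s) = - s by ring.
rewrite !subE !sub0E !sqiN.
have -> : y - y * z = - (y * (z - 1)) by ring.
have -> : y - y * w = - (y * (w - 1)) by ring.
rewrite !sqiN -mulrBr.
have := sqiM y z; have := sqiM y w; have := sqiM y (z - 1).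
have := sqiM y (w - 1); have := sqiM y (z - w).
rewrite /sqi; case: (qchi y == 1); rewrite ?mul0r // !mul1r => -> -> -> -> ->.
ring.
Qed.

End PaleyField.

(** * From Z/p^alpha to F_p *)

(** With A = a^(p^j), A^p - 1 = (A - 1)(1 + A + ... + A^(p-1)), and the last factor is a sum of p
    terms congruent to 1 modulo p. *)
Lemma dvdn_pred_exp (p a j : nat) : (0 < a)%N -> (p %| a.-1)%N ->
  (p ^ j.+1 %| (a ^ (p ^ j)).-1)%N.
Proof.
move=> a0 pa; elim: j => [|j IH]; first by rewrite expn0 !expn1.
rewrite (expnSr _ j) expnM predn_exp expnSr dvdn_mul //.
have [->|p0] := posnP p; first by rewrite big_ord0.
have a1 : (a ^ (p ^ j) = 1 %[mod p])%N.
  apply/eqP; rewrite eqn_mod_dvd ?expn_gt0 ?a0 // subn1.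
  exact: dvdn_trans (dvdn_exp _ (dvdnn p)) IH.
rewrite /dvdn -modn_summ (eq_bigr (fun=> 1 %% p)%N) => [|i _].
  by rewrite modn_summ sum1_card card_ord modnn.
by rewrite -modnXm a1 modnXm exp1n.
Qed.

Section Reduction.

Variables p alpha : nat.
Hypotheses (p_pr : prime p) (alpha_gt0 : (0 < alpha)%N).
Let n := (p ^ alpha)%N.

Lemma modulus_gt1 : (1 < n)%N.
Proof. by rewrite -(exp1n alpha) ltn_exp2r // prime_gt1. Qed.

Definition reduce (x : 'Z_n) : 'F_p := (x : nat)%:R.

Lemma reduce_natr m : reduce m%:R = m%:R.
Proof.
rewrite /reduce val_Zp_nat ?modulus_gt1 // -Fp_nat_mod // -[RHS]Fp_nat_mod //.
by rewrite modn_dvdm // dvdn_exp.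
Qed.

Lemma reduceD x y : reduce (x + y) = reduce x + reduce y.
Proof. by rewrite -{1}(natr_Zp x) -{1}(natr_Zp y) -natrD reduce_natr natrD. Qed.

Lemma reduceM x y : reduce (x * y) = reduce x * reduce y.
Proof. by rewrite -{1}(natr_Zp x) -{1}(natr_Zp y) -natrM reduce_natr natrM. Qed.

Lemma reduceB x y : reduce (x - y) = reduce x - reduce y.
Proof. by apply: (addIr (reduce y)); rewrite -reduceD !subrK. Qed.

Lemma reduce_surj c : {x | reduce x = c}.
Proof. by exists (c : nat)%:R; rewrite reduce_natr natr_Zp. Qed.

Lemma unit_reduce x : (x \is a GRing.unit) = (reduce x != 0).
Proof.
rewrite -{1}(natr_Zp x) unitZpE ?modulus_gt1 // /n coprime_pexpl // prime_coprime //.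
by rewrite (dvdn_pcharf (pchar_Fp p_pr)).
Qed.

(** The fibres of [reduce] are translates of its kernel, so they share a size k; the constant
    function 1 gives k p = p^alpha. *)
Lemma sum_reduce (G : 'F_p -> nat) :
  (\sum_(x : 'Z_n) G (reduce x) = p ^ alpha.-1 * \sum_c G c)%N.
Proof.
pose k := #|[pred x | reduce x == 0]|.
have sumE (H : 'F_p -> nat) : (\sum_(x : 'Z_n) H (reduce x) = k * \sum_c H c)%N.
  rewrite (partition_big reduce predT) // big_distrr; apply: eq_bigr => c _ /=.
  have [d dE] := reduce_surj c.
  rewrite (reindex_inj (addIr d)) /=.
  rewrite (eq_bigl [pred x | reduce x == 0]) => [|x]; last first.
    by rewrite reduceD dE -subr_eq0 addrK.
  rewrite (eq_bigr (fun=> H c)) ?sum_nat_const // => x /eqP x0.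
  by rewrite reduceD x0 add0r dE.
rewrite sumE; congr (_ * _)%N.
have := sumE (fun=> 1%N); rewrite !sum1_card card_Fp // card_ord Zp_cast ?modulus_gt1 //.
rewrite /n -{1}(prednK alpha_gt0) expnSr => /eqP.
by rewrite eqn_pmul2r ?prime_gt0 // => /eqP.
Qed.

(** With N = p^(alpha-1), which is odd, u^N = 1; hence u = u^(N+1) is the square of u^((N+1)/2). *)
Lemma reduce1_sqr u : odd p -> reduce u = 1 -> exists c, u = c ^+ 2.
Proof.
move=> p_odd u1.
have p1 := prime_gt1 p_pr.
have a1 : ((u : nat) = 1 %[mod p])%N.
  have := congr1 val u1; rewrite /= !val_Fp_nat //.
  by rewrite [(1 %% p)%N]modn_small.
have a0 : (0 < u)%N.
  by rewrite lt0n; apply/eqP => a0; move: a1; rewrite a0 mod0n modn_small.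
have uN : u ^+ (p ^ alpha.-1) = 1.
  have pa : (p %| (u : nat).-1)%N by rewrite -subn1 -eqn_mod_dvd //; apply/eqP.
  have := dvdn_pred_exp alpha.-1 a0 pa; rewrite prednK // => /dvdnP [t tE].
  rewrite -[in LHS](natr_Zp u) -natrX -[((u : nat) ^ _)%N]prednK ?expn_gt0 ?a0 //.
  by rewrite tE -natr1 natrM -/n pchar_Zp ?modulus_gt1 // mulr0 add0r.
exists (u ^+ ((p ^ alpha.-1).+1 %/ 2)).
rewrite -exprM divnK ?exprS ?uN ?mulr1 //.
by rewrite dvdn2 /= oddX p_odd orbT.
Qed.

End Reduction.

(** * Adjacency and ordered cliques under reduction *)

Section BlowUp.

Variables p alpha : nat.
Hypotheses (p_pr : prime p) (p_mod4 : (p = 1 %[mod 4])%N) (alpha_gt0 : (0 < alpha)%N).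

(** If x - y reduces to d^2 with d != 0, lift d to a unit c; then (x - y) / c^2 reduces to 1 and so
    is a square. *)
Lemma paley_edge_reduce (x y : 'Z_(p ^ alpha)) :
  paley_edge (p ^ alpha) x y = paley_rel (reduce x) (reduce y).
Proof.
have F4 : (#|'F_p| = 1 %[mod 4])%N by rewrite card_Fp.
have p_odd : odd p by rewrite (divn_eq p 4) p_mod4 oddD oddM andbF.
rewrite /paley_rel -reduceB //; apply/existsP/idP => [[c]|/eqP xy1].
  rewrite unit_reduce // => /andP[c0 /eqP->].
  by rewrite expr2 reduceM // -expr2 qchi_sq.
have xy0 : reduce (x - y) != 0 by rewrite -qchi_eq0 xy1.
have [[d d0 dE]|] := qchiP xy0; last by rewrite xy1.
have [c cE] := reduce_surj p_pr alpha_gt0 d.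
have cU : c \is a GRing.unit by rewrite unit_reduce // cE.
have [v vE] : exists v, (x - y) / c ^+ 2 = v ^+ 2.
  apply: reduce1_sqr => //; apply: (mulIf (expf_neq0 2 d0)).
  have -> : d ^+ 2 = reduce (c ^+ 2) by rewrite !expr2 reduceM // cE.
  by rewrite -reduceM // divrK ?unitrX // mul1r dE !expr2 reduceM // cE.
have xyE : x - y = (v * c) ^+ 2 by rewrite exprMn -vE divrK ?unitrX.
exists (v * c); rewrite xyE eqxx andbT.
have : (v * c) ^+ 2 \is a GRing.unit by rewrite -xyE unit_reduce.
by rewrite unitrX_pos.
Qed.

Lemma paley_edge_sym : symmetric (paley_edge (p ^ alpha)).
Proof.
move=> x y; rewrite !paley_edge_reduce /paley_rel -opprB qchiN //.
by rewrite card_Fp.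
Qed.

Lemma paley_edge_irr : irreflexive (paley_edge (p ^ alpha)).
Proof. by move=> x; rewrite paley_edge_reduce /paley_rel subrr qchi0. Qed.

Lemma ordered_cliques4_paley_edge :
  ordered_cliques4 (paley_edge (p ^ alpha)) =
  ((p ^ alpha.-1) ^ 4 * ordered_cliques4 (@paley_rel 'F_p))%N.
Proof.
set k := (p ^ alpha.-1)%N; pose e := @paley_rel 'F_p.
pose f x y z w : nat := (e x y * e x z * e x w * e y z * e y w * e z w)%N.
rewrite [RHS](_ : _ = k * \sum_x k * \sum_y k * \sum_z k * \sum_w f x y z w)%N.
  rewrite -sum_reduce //; apply: eq_bigr => x _.
  rewrite -sum_reduce //; apply: eq_bigr => y _.
  rewrite -sum_reduce //; apply: eq_bigr => z _.
  rewrite -sum_reduce //; apply: eq_bigr => w _.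
  by rewrite !paley_edge_reduce.
rewrite expnS -mulnA big_distrr; congr (_ * _)%N; apply: eq_bigr => x _ /=.
rewrite expnS -mulnA big_distrr; congr (_ * _)%N; apply: eq_bigr => y _ /=.
rewrite expnS -mulnA big_distrr; congr (_ * _)%N; apply: eq_bigr => z _ /=.
Qed.

End BlowUp.

Theorem corollary1p5 (p alpha : nat) (a b : int)
    (p_prime : prime p) (p_mod4 : (p = 1 %[mod 4])%N)
    (alpha_gt0 : (0 < alpha)%N)
    (p_sum : p%:Z = a ^+ 2 + b ^+ 2) (a_even : (2 %| a)%Z) :
  (num_cliques (paley_edge (p ^ alpha)) 4)%:R =
    p%:R ^+ (4 * alpha - 3) * (p%:R - 1)
      * ((p%:R - 9) ^+ 2 - 4 * a%:~R ^+ 2) / 1536 :> rat.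
Proof.
have card4 : (#|'F_p| = 1 %[mod 4])%N by rewrite card_Fp.
set K := num_cliques _ _.
have K24 : 24 * K%:Z = p%:Z ^+ (4 * (alpha.-1)) * (ordered_cliques4 (@paley_rel 'F_p))%:Z.
  rewrite -PoszM num_cliques4; [|exact: paley_edge_sym|exact: paley_edge_irr].
  rewrite ordered_cliques4_paley_edge // -expnM [(_.-1 * 4)%N]mulnC PoszM.
  by rewrite -[X in X * _]natz natrX natz.
have K1536 : K%:Z * 1536 = p%:Z ^+ (4 * alpha - 3) * (p%:Z - 1)
    * ((p%:Z - 9) ^+ 2 - 4 * a ^+ 2).
  (* Four vertices give p^(4(alpha-1)); the further factor p is the choice of the first vertex in
     F_p. *)
  have -> : (4 * alpha - 3 = (4 * alpha.-1).+1)%N by case: (alpha) alpha_gt0 => // m _; lia.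
  have S1 := sum_sqi card4; have S2 := paley_edgesE card4.
  rewrite (clique_sum_two_squares p_prime p_mod4 p_sum a_even) card_Fp // in S1 S2.
  (* 64 = 2 * 32, with 2 from the number of nonzero squares and 32 from [paley_edges]. *)
  have -> : K%:Z * 1536 = 64 * (24 * K%:Z) by ring.
  rewrite K24 ordered_cliques4_paley // card_Fp // -S1.
  (* Substituting T = 2 p - 4 a^2 turns p^2 - 20 p + 81 + T into (p - 9)^2 - 4 a^2. *)
  have -> : (p%:Z - 9) ^+ 2 - 4 * a ^+ 2 = 32 * paley_edges 'F_p by rewrite S2; ring.
  by rewrite exprSr; ring.
have rat_neq0 : 1536 != 0 :> rat by rewrite pnatr_eq0.
apply: (mulIf rat_neq0); rewrite (divfK rat_neq0).
have := congr1 (fun z : int => z%:~R : rat) K1536.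
rewrite !(rmorphM, rmorphXn, rmorphB, rmorph_nat, rmorph1).
exact.
Qed.
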